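(* Let $n\ge 2$ and let $1=k_1<k_2<\dots<k_\ell=n$ be positive integers with $k_s\mid n$ for all $1\le s\le \ell$. Let $i,j$ be integers with $0\le i,j$ and $i+j<n$. The following statements are equivalent: (1) There exists a number field $K$ of degree $n$ whose subfields have precisely the degrees $k_1,\dots,k_\ell$, and a constant $c_K>0$ depending only on $K$, such that $\lambda_{i+j}(\mathcal O)\le c_K\lambda_i(\mathcal O)\lambda_j(\mathcal O)$ for every order $\mathcal O\subseteq K$. (2) There exists a number field $K$ of degree $n$ whose subfields have precisely the degrees $k_1,\dots,k_\ell$, and a constant $c_K>0$ depending only on $K$, such that $\lambda_{i+j}(I)\le c_K\lambda_i(I)\lambda_j(\mathcal O)$ for every order $\mathcal O\subseteq K$ and every fractional ideal $I$ of $\mathcal O$. (3) For every order $\mathcal O$ in a degree $n$ number field such that $\mathcal O\otimes\mathbb Q$ has subfields of precisely the degrees $k_1,\dots,k_\ell$, we have $\lambda_{i+j}(\mathcal O)\le\sqrt n\,\lambda_i(\mathcal O)\lambda_j(\mathcal O)$. (4) For every order $\mathcal O$ in a degree $n$ number field such that $\mathcal O\otimes\mathbb Q$ has subfields of precisely the degrees $k_1,\dots,k_\ell$, and every fractional ideal $I$ of $\mathcal O$, we have $\lambda_{i+j}(I)\le\sqrt n\,\lambda_i(I)\lambda_j(\mathcal O)$. (5) $(i \bmod k_s)+(j\bmod k_s)=(i+j)\bmod k_s$ for all $1\le s\le\ell$.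
   Context: For a number field $K$ of degree $n$ with complex embeddings $\sigma_1,\dots,\sigma_n$, define $|x|=\sqrt{\frac1n\sum_{m=1}^n|\sigma_m(x)|^2}$ for $x\in K$. For a full rank lattice $\Lambda\subset K$ (a subgroup isomorphic to $\mathbb Z^n$) and $i\in\{0,\dots,n-1\}$, the $i$-th successive minimum is $\lambda_i(\Lambda)=\min\{r>0:\dim_{\mathbb Q}\mathrm{Span}_{\mathbb Q}\{x\in\Lambda: |x|\le r\}\ge i+1\}$. Orders and their fractional ideals are full rank lattices. For integers $a\ge0$, $b>0$, $a\bmod b\in\{0,\dots,b-1\}$ denotes the remainder.
   Formalization: Adds the hypothesis that some degree n number field has subfields of precisely the degrees k_1,…,k_ℓ; without one (e.g. n=12, degrees 1,2,3,12) statements (3),(4) hold vacuously while (1),(2) fail, so the printed equivalence is false. *)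

(* Defs.v *)
From HB Require Import structures.
From mathcomp Require Import all_boot all_order all_algebra all_field.
From mathcomp Require Import boolp classical_sets fsbigop reals complex.

Set Implicit Arguments.
Unset Strict Implicit.
Unset Printing Implicit Defensive.

Import Order.TTheory GRing.Theory Num.Theory.

Local Open Scope classical_set_scope.
Local Open Scope ring_scope.

(* A number field is a [K : fieldExtType rat]; its degree is [\dim {:K}], and
   [{subfield K}] is the type of all its subfields, since each of them is a
   Q-subspace of K. *)

Definition subfields_have_degrees (K : fieldExtType rat) (ks : seq nat) : Prop :=
  forall d : nat, (exists F : {subfield K}, \dim F = d) <-> d \in ks.

(* The embeddings are indexed by their underlying functions, so that the type
   of indices has the choice structure required by [\sum_(_ \in _)]. The set is
   finite (it has [\dim {:K}] elements), as the sum below needs: summing over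
   an infinite support would give 0. *)
Definition embeddings (R : realType) (K : fieldExtType rat) : set (K -> R[i]) :=
  range (fun s : {rmorphism K -> R[i]} => (s : K -> R[i])).
Arguments embeddings : clear implicits.

Definition absK (R : realType) (K : fieldExtType rat) (x : K) : R :=
  Num.sqrt ((\dim {:K})%:R^-1 *
    \sum_(s \in embeddings R K) ComplexField.Normc.normc (s x) ^+ 2).

Definition full_rank_lattice (K : fieldExtType rat) (L : set K) : Prop :=
  exists phi : {additive 'rV[int]_(\dim {:K}) -> K},
    injective phi /\ L = range phi.

Definition is_order (K : fieldExtType rat) (O : set K) : Prop :=
  subring_closed (mem O) /\ full_rank_lattice O.

Definition fractional_ideal (K : fieldExtType rat) (O I : set K) : Prop :=
  [/\ I 0,
      forall x y, I x -> I y -> I (x + y),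
      forall a x, O a -> I x -> I (a * x),
      exists2 x, I x & x != 0
    & exists2 d, O d /\ d != 0 & forall x, I x -> O (d * x)].

(* The smallest Q-subspace containing S; it always exists, so that the default
   value is irrelevant. *)
Definition qspan (K : fieldExtType rat) (S : set K) : {vspace K} :=
  xget 0%VS [set U : {vspace K} | (forall x, S x -> x \in U) /\
    (forall V : {vspace K}, (forall x, S x -> x \in V) -> (U <= V)%VS)].

(* The default value is irrelevant when a minimum exists, as it does for the
   successive minima of index i < \dim {:K} of a full rank lattice. *)
Definition min_set (R : realType) (A : set R) : R :=
  xget 0 [set r | A r /\ forall s, A s -> r <= s].

Definition succ_min (R : realType) (K : fieldExtType rat) (i : nat)
    (L : set K) : R :=
  min_set [set r : R | 0 < r /\
    (i.+1 <= \dim (qspan [set x | L x /\ (absK R x <= r)%R]))%N].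

(* Main.v *)
(** (5) => (4): let A be spanned by the elements of I of size at most
    lambda_i(I), and B by those of O of size at most lambda_j(O). Products
    satisfy |xy| <= sqrt n |x| |y|, so it suffices that dim AB > i + j. The
    linear analogue of Kneser's theorem (Hou, Leung, Xiang) gives a subfield H
    with dim AB >= dim HA + dim HB - dim H; the first two dimensions are
    multiples of k = dim H, at least k(i div k + 1) and k(j div k + 1), and (5)
    for this k says that i div k + j div k = (i + j) div k.

    (1) => (5): for a subfield F = Q(b) of degree k and K = F(a), the lattices
    spanned by the T^(p div k) b^(p mod k) a^(p div k), p < n, become orders
    after multiplying all but the first generator by a fixed integer N. Their
    p-th minimum grows like T^(p div k), so if (5) fails for k then
    lambda_(i+j) / (lambda_i lambda_j) grows at least like T. *)

Require Import Defs.
From HB Require Import structures.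
From mathcomp Require Import all_boot all_order all_algebra all_field.
From mathcomp Require Import boolp classical_sets fsbigop reals complex.
From mathcomp Require Import zify.

Set Implicit Arguments.
Unset Strict Implicit.
Unset Printing Implicit Defensive.

Import Order.TTheory GRing.Theory Num.Theory.

Local Open Scope ring_scope.

(** * Kneser's theorem for subspaces of a number field *)

Section Kneser.
Variables (F : fieldType) (K : fieldExtType F).
Implicit Types (A B U V : {vspace K}).

(* By induction on [\dim A]: unless [A * B = B], some [e] in [B] makes the
   e-transform [(A :&: B e^-1, B + A e)] shrink [A]; it preserves the sum of
   the dimensions, and its product stays inside [A * B]. *)
Lemma stabilized_subspace1 A B : 1 \in A ->
  exists (H : {subfield K}) V,
    [/\ (H * V <= V)%VS, (B <= V)%VS, (V <= A * B)%VS &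
        (\dim A + \dim B <= \dim V + \dim H)%N].
Proof.
have [m] := ubnP (\dim A); elim: m A B => // m IHm A B leAm A1.
have [[e Be]|AB] := pselect (exists2 e, e \in B & ~~ (A * <[e]> <= B)%VS).
  have [-> /negP[]|e0 nAeB] := eqVneq e 0.
    by rewrite prodv0 sub0v.
  have ev0 : e^-1 != 0 by rewrite invr_eq0.
  have eK : (<[e]> * <[e^-1]> = 1)%VS by rewrite prodv_line divff.
  have eK' : (<[e^-1]> * <[e]> = 1)%VS by rewrite prodvC eK.
  pose A' := (A :&: (B * <[e^-1]>))%VS; pose B' := (B + A * <[e]>)%VS.
  have A'e : (A' * <[e]> = B :&: (A * <[e]>))%VS.
    apply/eqP; rewrite eqEsubv; apply/andP; split.
      rewrite subv_cap (prodvSl _ (capvSl _ _)) andbT.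
      by apply: subv_trans (prodvSl _ (capvSr _ _)) _; rewrite -prodvA eK' prodv1.
    rewrite -[X in (X <= _)%VS]prodv1 -eK' prodvA prodvSl // subv_cap.
    rewrite [X in _ && X]prodvSl ?capvSl // andbT.
    by apply: subv_trans (prodvSl _ (capvSr _ _)) _; rewrite -prodvA eK prodv1.
  have dimS : (\dim A' + \dim B' = \dim A + \dim B)%N.
    rewrite -(dim_cosetv A' e0) A'e addnC /B' dimv_sum_cap addnC.
    by rewrite dim_cosetv.
  (* [A' = A] would give [A * <[e]> <= B], against the choice of [e]. *)
  have ltA' : (\dim A' < m)%N.
    rewrite ltnS in leAm; apply: leq_trans leAm.
    rewrite (ltn_leqif (dimv_leqif_sup (capvSl A _))).
    apply: contra nAeB; rewrite subv_cap => /andP[_ h].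
    by apply: subv_trans (prodvSl _ h) _; rewrite -prodvA eK' prodv1.
  have A'1 : 1 \in A'.
    by rewrite memv_cap A1 -(divff e0) memv_mul ?memv_line.
  have [H [V [HV BV VA le]]] := IHm A' B' ltA' A'1.
  exists H, V; split=> //; last by rewrite -dimS.
    exact: subv_trans (addvSl _ _) BV.
  apply: subv_trans VA _; rewrite /B' prodvDr subv_add prodvSl ?capvSl //=.
  rewrite prodvA prodvC prodvA prodvC prodvSr // prodvC A'e.
  exact: capvSl.
(* No [e] is left, so [A] maps [B] into itself, and so does the field that [A] generates. *)
have {}AB : (A * B <= B)%VS.
  apply/prodvP => a b Aa Bb; have [//|nab] := boolP (a * b \in B).
  case: AB; exists b => //; apply: contra nab => /subvP; apply.
  by rewrite memv_mul ?memv_line.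
exists <<A>>%AS, B; split=> //; first exact: agenv_modl.
  by rewrite -[X in (X <= _)%VS]prod1v prodvSl // -memvE.
by rewrite addnC leq_add2l dimvS // sub_agenv.
Qed.

(** Scaling [A] by [a^-1] brings 1 into it; the space found there is scaled back by [a]. *)
Lemma stabilized_subspace A B a : a \in A -> a != 0 ->
  exists (H : {subfield K}) V,
    [/\ (H * V <= V)%VS, (<[a]> * B <= V)%VS, (V <= A * B)%VS &
        (\dim A + \dim B <= \dim V + \dim H)%N].
Proof.
move=> Aa a0; have av0 : a^-1 != 0 by rewrite invr_eq0.
have A1 : 1 \in (A * <[a^-1]>)%VS by rewrite -(divff a0) memv_mul ?memv_line.
have [H [V [HV BV VA le]]] := stabilized_subspace1 B A1.
exists H, (<[a]> * V)%VS; split.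
- by rewrite prodvA (prodvC H) -prodvA prodvSr.
- exact: prodvSr.
- apply: subv_trans (prodvSr _ VA) _.
  by rewrite (prodvC A) !prodvA prodv_line divff // prod1v.
by rewrite (prodvC _ V) dim_cosetv // -(dim_cosetv A av0).
Qed.

(* [minPoly E1 x] has coefficients in [E1 :&: E2], over which [x] thus has the
   same degree as over [E1]. *)
Lemma subfield_minPoly_inj (x : K) (E1 E2 : {subfield K}) :
  <<1; x>>%VS = fullv -> minPoly E1 x = minPoly E2 x -> E1 = E2 :> {vspace K}.
Proof.
move=> x_gen eq_min.
have adj (E : {subfield K}) : <<E; x>>%VS = fullv.
  apply/eqP; rewrite eqEsubv subvf /= -x_gen.
  by apply: agenvS; rewrite addvS // sub1v.
suff sub (E E' : {subfield K}) : minPoly E x = minPoly E' x -> (E <= E')%VS.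
  by apply/eqP; rewrite eqEsubv !sub.
move=> {}eq_min.
pose I := (E :&: E')%AS.
have Imin : minPoly E x \is a polyOver I.
  apply/polyOverP => i; rewrite memv_cap {2}eq_min.
  by rewrite !(polyOverP (minPolyOver _ _)).
have := dvdp_leq (monic_neq0 (monic_minPoly E x)) (minPoly_dvdp Imin (root_minPoly E x)).
rewrite !size_minPoly ltnS !adjoin_degreeE !adj => le.
apply: subv_trans (capvSr E E').
rewrite -(geq_leqif (dimv_leqif_sup (capvSl E E'))).
(* [K] has degree at most [\dim_E {:K}] over [I], so multiplicativity of degrees leaves no room for
   [I] to be smaller than [E]. *)
have K_gt0 : (0 < \dim_E {:K})%N by rewrite divn_gt0 ?adim_gt0 // dimvS ?subvf.
rewrite -(leq_pmul2l K_gt0) -(dim_sup_field (subvf E)).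
by rewrite [leqLHS](dim_sup_field (subvf I)) leq_mul2r le orbT.
Qed.

End Kneser.

(** * Rational spans and avoidance of proper subspaces *)

Lemma qspanP (K : fieldExtType rat) (S : set K) :
  (forall x, S x -> x \in qspan S) /\
  (forall V : {vspace K}, (forall x, S x -> x \in V) -> (qspan S <= V)%VS).
Proof.
apply: (@xgetPex _ 0%VS (fun U => (forall x, S x -> x \in U) /\
  (forall V : {vspace K}, (forall x, S x -> x \in V) -> (U <= V)%VS))).
pose cover (U : {vspace K}) := forall x, S x -> x \in U.
pose P m := `[< exists U, cover U /\ \dim U = m >].
have exP : exists m, P m.
  by exists (\dim {:K}); apply/asboolP; exists fullv; split=> // x _; apply: memvf.
have [_ /asboolP[U [SU <-]] minU] := ex_minnP exP.
exists U; split=> // V SV.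
(* [U] has minimal dimension among the spaces containing [S], and [U :&: V] is another one. *)
have /minU leU : P (\dim (U :&: V)).
  by apply/asboolP; exists (U :&: V)%VS; split=> // x Sx; rewrite memv_cap SU ?SV.
apply: subv_trans (capvSr U V).
by rewrite -(geq_leqif (dimv_leqif_sup (capvSl U V))).
Qed.

Lemma mem_qspan (K : fieldExtType rat) (S : set K) x : S x -> x \in qspan S.
Proof. by case: (qspanP S) => h _; apply: h. Qed.

Lemma qspan_sub (K : fieldExtType rat) (S : set K) (V : {vspace K}) :
  (forall x, S x -> x \in V) -> (qspan S <= V)%VS.
Proof. by case: (qspanP S) => _; apply. Qed.

(** For fixed [b], the [x] with [x * b] in [W] form a subspace, so generators suffice. *)
Lemma prodv_sub_of_gen (K : fieldExtType rat) (S : set K) (B W : {vspace K}) :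
  (forall x b, S x -> b \in B -> x * b \in W) -> (qspan S * B <= W)%VS.
Proof.
move=> SBW; apply/prodvP => x b xS bB.
have /subvP/(_ x xS) : (qspan S <= amulr b @^-1: W)%VS.
  by apply: qspan_sub => y Sy; rewrite -memv_preim lfunE; apply: SBW.
by rewrite -memv_preim lfunE.
Qed.

(** A subspace containing two points of the line would contain their difference, a nonzero multiple
    of [a]; hence each subspace excludes at most one [t]. *)
Lemma line_avoids_subspaces (vT : vectType rat) (a b : vT)
    (s : seq {vspace vT}) :
  (forall U, U \in s -> a \notin U) ->
  exists m, forall t : nat, (m <= t)%N ->
    forall U, U \in s -> b + t%:R *: a \notin U.
Proof.
elim: s => [|V s IHs] aP; first by exists 0%N.
have [|m mP] := IHs; first by move=> U sU; rewrite aP // inE sU orbT.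
have [[t0 Vt0]|nV] := pselect (exists t0 : nat, b + t0%:R *: a \in V).
  exists (maxn m t0.+1) => t; rewrite geq_max => /andP[mt t0t] U.
  rewrite inE => /orP[/eqP->|]; last exact: mP.
  apply/negP => Vt; have := aP V (mem_head _ _).
  have := memvB Vt Vt0; rewrite opprD addrACA subrr add0r -scalerBl.
  rewrite -natrB 1?ltnW // => /(memvZ (t - t0)%:R^-1).
  rewrite scalerA mulVf ?scale1r => [->//|].
  by rewrite pnatr_eq0 subn_eq0 -ltnNge.
exists m => t mt U; rewrite inE => /orP[/eqP->|]; last exact: mP.
by apply/negP => Vt; apply: nV; exists t.
Qed.

Lemma avoid_proper_subspaces (vT : vectType rat) (A : {vspace vT})
    (s : seq {vspace vT}) :
  (forall U, U \in s -> ~~ (A <= U)%VS) ->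
  exists2 a, a \in A & forall U, U \in s -> a \notin U.
Proof.
elim: s => [|V s IHs] sP; first by exists 0; rewrite ?mem0v.
have [|a Aa aP] := IHs; first by move=> U sU; rewrite sP // inE sU orbT.
have [Va|nVa] := boolP (a \in V); last first.
  by exists a => // U; rewrite inE => /orP[/eqP->|/aP].
(* Since [a] lies in [V], moving [b] along [a] never enters [V], and far enough along it avoids the
   other subspaces too. *)
have /subvPn[b Ab nVb] := sP V (mem_head _ _).
have [m /(_ m (leqnn m)) mP] := line_avoids_subspaces b aP.
exists (b + m%:R *: a); first by rewrite memvD ?memvZ.
move=> U; rewrite inE => /orP[/eqP->|]; last exact: mP.
by apply: contra nVb => /memvB/(_ (memvZ m%:R Va)); rewrite addrK.
Qed.

(** * Kneser's theorem from its version for a single vector *)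

Section KneserNumberField.
Variables (K : fieldExtType rat) (s : seq {vspace K}).
Hypothesis sP : forall E : {subfield K}, (E : {vspace K}) \in s.
Implicit Types (A B V : {vspace K}).

(* [A] is covered by the finitely many spans of the [a] that are good for a
   given subfield, hence by one of them, since [rat] is infinite. *)
Lemma kneser_stabilizer A B : A != 0%VS ->
  exists H : {subfield K}, (H * (A * B) <= A * B)%VS /\
    (\dim A + \dim B <= \dim (A * B) + \dim H)%N.
Proof.
move=> A0.
(* [H] is only a vector space, with [H'] as its subfield structure, so that it can run through the
   list [s]. *)
pose good (H : {vspace K}) (a : K) := a \in A /\ exists (H' : {subfield K}) V,
  [/\ H = H' :> {vspace K}, (H * V <= V)%VS, (<[a]> * B <= V)%VS,
      (V <= A * B)%VS & (\dim A + \dim B <= \dim V + \dim H)%N].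
have [[H AH]|nocover] :=
    pselect (exists H, (A <= qspan (good H))%VS); last first.
  have [|a Aa aP] := @avoid_proper_subspaces _ A [seq qspan (good H) | H <- s].
    by move=> _ /mapP[H _ ->]; apply/negP => AH; apply: nocover; exists H.
  have a0 : a != 0.
    have := aP _ (map_f (fun H => qspan (good H)) (sP 1%AS)).
    by apply: contraNneq => ->; rewrite mem0v.
  have [H [V [HV aV VA le]]] := stabilized_subspace B Aa a0.
  have := aP _ (map_f (fun H => qspan (good H)) (sP H)).
  by rewrite mem_qspan //; split=> //; exists H, V.
have [[a [_ [H' [V [eqH HV aV VA le]]]]]|noa] := pselect (exists a, good H a).
  exists H'; split; last by rewrite -eqH (leq_trans le) // leq_add2r dimvS.
  (* Each good [x] has its own [V'] with [H * <[x]> * B <= H * V' <= V' <= A * B], and the good [x]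
     span a space containing [A]. *)
  apply: subv_trans (_ : qspan (good H) * (H * B) <= _)%VS.
    by rewrite -eqH (prodvA H) (prodvC H A) -(prodvA A) prodvSl.
  apply: prodv_sub_of_gen => {aV HV VA le}x hb [_ [_ [V' [_ HV xV VA _]]]] HBhb.
  apply: (subvP (subv_trans HV VA)); apply: (subvP (prodvSr _ xV)).
  by rewrite prodvA (prodvC H <[x]>%VS) -prodvA memv_mul ?memv_line.
have : (qspan (good H) <= 0)%VS.
  by apply: qspan_sub => x gx; case: noa; exists x.
by move/(subv_trans AH); rewrite subv0 (negPf A0).
Qed.

(* Apply the previous lemma to [H * A] and [H * B], with [H] of maximal
   dimension among the subfields stabilizing [A * B]. *)
Lemma kneser_saturated A B : A != 0%VS ->
  exists H : {subfield K},
    (\dim (H * A) + \dim (H * B) <= \dim (A * B) + \dim H)%N.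
Proof.
move=> A0.
pose P m := `[< exists H : {subfield K},
  (H * (A * B) <= A * B)%VS /\ \dim H = m >].
have exP : exists m, P m.
  by exists (\dim (1%AS : {subfield K})); apply/asboolP; exists 1%AS; rewrite prod1v.
have ubP m : P m -> (m <= \dim {:K})%N.
  by move=> /asboolP[H [_ <-]]; rewrite dimvS ?subvf.
have [_ /asboolP[H [HAB <-]] maxH] := ex_maxnP exP ubP.
have subH (C : {vspace K}) : (C <= H * C)%VS.
  by rewrite -[X in (X <= _)%VS]prod1v prodvSl // sub1v.
have [|H' [H'AB le]] := @kneser_stabilizer (H * A) (H * B).
  by apply: contraNneq A0 => HA0; rewrite -subv0 -HA0 subH.
have eqAB : (H * A * (H * B) = A * B)%VS.
  have -> : (H * A * (H * B) = H * (A * B))%VS.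
    by rewrite prodvA (prodvC _ H) prodvA prodv_id prodvA.
  by apply/eqP; rewrite eqEsubv HAB subH.
rewrite eqAB in H'AB le; exists H; apply: leq_trans le _.
by rewrite leq_add2l maxH //; apply/asboolP; exists H'.
Qed.

Lemma dim_prodv_ge A B (i j : nat) :
    (forall H : {subfield K}, i %% \dim H + j %% \dim H = (i + j) %% \dim H)%N ->
  (i < \dim A)%N -> (j < \dim B)%N -> (i + j < \dim (A * B))%N.
Proof.
move=> modP iA jB.
have A0 : A != 0%VS by rewrite -dimv_eq0; case: (\dim A) iA.
have [H le] := kneser_saturated B A0.
have k_gt0 : (0 < \dim H)%N by exact: adim_gt0.
(* [H * C] is an [H]-space of dimension above [m], hence at least the next multiple of [\dim H]. *)
have dim_ge (C : {vspace K}) (m : nat) : (m < \dim C)%N ->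
    ((m %/ \dim H).+1 * \dim H <= \dim (H * C))%N.
  move=> mC; have : (H * (H * C) <= H * C)%VS by rewrite prodvA prodv_id.
  move/field_module_dimS/divnK => <-; rewrite leq_pmul2r // ltn_divLR //.
  rewrite divnK; last by apply: field_module_dimS; rewrite prodvA prodv_id.
  apply: leq_trans mC _; apply: dimvS.
  by rewrite -[X in (X <= _)%VS]prod1v prodvSl // sub1v.
move: (leq_add (dim_ge _ _ iA) (dim_ge _ _ jB)) => /leq_trans/(_ le).
(* The residues add without carry, so the quotients add; the spare [\dim H] cancels against the one
   in Kneser's bound. *)
have -> : ((i %/ \dim H).+1 * \dim H + (j %/ \dim H).+1 * \dim H =
  ((i + j) %/ \dim H).+1 * \dim H + \dim H)%N.
  have /eqP := modP H; rewrite -(eqn_add2l (i %/ \dim H * \dim H + j %/ \dim H * \dim H)).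
  rewrite addnACA -!divn_eq => /eqP eqm.
  have /eqP := divn_eq (i + j) (\dim H); rewrite {1}eqm eqn_add2r.
  by rewrite -mulnDl => /eqP eqd; rewrite !mulSn -eqd mulnDl; lia.
by rewrite leq_add2r; apply: leq_trans; rewrite ltn_ceil.
Qed.
End KneserNumberField.

(** * Embeddings and subfields of a number field *)

Section PrimitiveElement.
Variables (K : fieldExtType rat) (theta : K).
Hypothesis theta_gen : <<1; theta>>%VS = fullv.

(** The minimal polynomial of [theta] has its coefficients in [K]; [p] is its rational form, which
    can be mapped to any [L]. *)
Variable p : {poly rat}.
Hypothesis pE : map_poly (in_alg K) p = minPoly 1 theta.

Lemma size_rat_minPoly : size p = (\dim {:K}).+1.
Proof.
rewrite -(size_map_poly (in_alg K)) pE size_minPoly adjoin_degreeE.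
by rewrite theta_gen dimv1 divn1.
Qed.

Lemma monic_rat_minPoly : p \is monic.
Proof. by rewrite -(map_monic (in_alg K)) pE monic_minPoly. Qed.

Lemma horner_theta_surj (x : K) :
  exists q : {poly rat}, (map_poly (in_alg K) q).[theta] = x.
Proof.
have : x \in <<1; theta>>%VS by rewrite theta_gen memvf.
by case/Fadjoin_polyP => _ /polyOver1P[q ->] ->; exists q.
Qed.

Variable L : numClosedFieldType.

Lemma minPoly_root_vanish (r : L) (q : {poly rat}) :
  root (map_poly ratr p) r -> (map_poly (in_alg K) q).[theta] = 0 ->
  (map_poly ratr q).[r] = 0.
Proof.
move=> rr /eqP q0.
have Kq : map_poly (in_alg K) q \is a polyOver 1%VS.
  by apply/polyOver1P; exists q.
have := @minPoly_dvdp _ _ 1%AS theta _ Kq q0.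
rewrite -pE dvdp_map -(dvdp_map (@ratr L)) => /dvdpP[u ->].
by rewrite hornerM (rootP rr) mulr0.
Qed.

Lemma rmorphism_of_root (r : L) : root (map_poly ratr p) r ->
  exists s : {rmorphism K -> L}, s theta = r.
Proof.
move=> rr; have [q qP] := choice horner_theta_surj.
pose s x := (map_poly ratr (q x)).[r] : L.
(* The value does not depend on the chosen [q x]: two choices differ by a polynomial vanishing at
   [theta], hence at [r]. *)
have sE v : s (map_poly (in_alg K) v).[theta] = (map_poly ratr v).[r].
  apply/eqP; rewrite -subr_eq0 /s -hornerN -hornerD -rmorphB.
  by rewrite minPoly_root_vanish // rmorphB !hornerE qP subrr.
have sB : {morph s : x y / x - y}.
  move=> x y; rewrite -{1}(qP x) -{1}(qP y) -hornerN -hornerD -rmorphB sE.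
  by rewrite rmorphB !hornerE.
have sM : monoid_morphism s.
  split; first by have := sE 1%:P; rewrite !map_polyC !hornerC /= rmorph1 scale1r.
  move=> x y; rewrite -{1}(qP x) -{1}(qP y) -hornerM -rmorphM sE.
  by rewrite rmorphM !hornerE.
pose s' : {rmorphism K -> L} := HB.pack s
  (GRing.isZmodMorphism.Build K L s sB) (GRing.isMonoidMorphism.Build K L s sM).
exists s'; have := sE 'X; rewrite !map_polyX !hornerX; exact.
Qed.

Lemma horner_rmorphism (s : {rmorphism K -> L}) (q : {poly rat}) :
  s (map_poly (in_alg K) q).[theta] = (map_poly ratr q).[s theta].
Proof.
rewrite -horner_map -map_poly_comp; congr _.[_].
by apply: eq_map_poly; apply: (fmorph_eq_rat (s \o in_alg K)).
Qed.

Lemma root_rmorphism (s : {rmorphism K -> L}) : root (map_poly ratr p) (s theta).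
Proof. by rewrite /root -horner_rmorphism pE minPolyxx rmorph0. Qed.

Lemma rmorphism_theta_inj (s t : {rmorphism K -> L}) :
  s theta = t theta -> s =1 t.
Proof.
by move=> st x; have [q <-] := horner_theta_surj x; rewrite !horner_rmorphism st.
Qed.

(** Embeddings correspond to roots of [p] in [L], which are distinct because [p] is separable in
    characteristic 0. *)
Lemma exists_all_embeddings : exists s : 'I_(\dim {:K}) -> {rmorphism K -> L},
  injective (fun m => s m theta) /\ forall t : {rmorphism K -> L}, exists m, t =1 s m.
Proof.
have [rs prs] := closed_field_poly_normal (map_poly (ratr : rat -> L) p).
rewrite (monicP _) ?map_monic ?monic_rat_minPoly // scale1r in prs.
have rs_uniq : uniq rs.
  rewrite -separable_prod_XsubC -prs separable_map.
  rewrite -(separable_map (in_alg K)) pE.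
  by apply: pcharf0_separable; move=> x; rewrite pchar_lalg pchar_num.
have sz_rs : size rs = \dim {:K}.
  apply/succn_inj; rewrite -size_rat_minPoly.
  by rewrite -(size_map_poly (ratr : rat -> L)) prs size_prod_XsubC.
have rootE z : root (map_poly ratr p) z = (z \in rs).
  by rewrite prs root_prod_XsubC.
have sP (m : 'I_(\dim {:K})) : exists s : {rmorphism K -> L}, s theta = rs`_m.
  by apply: rmorphism_of_root; rewrite rootE mem_nth ?sz_rs.
have [s {}sP] := choice sP; exists s; split.
  by move=> m m'; rewrite !sP => /eqP; rewrite nth_uniq ?sz_rs // => /eqP/val_inj.
move=> t; have := root_rmorphism t; rewrite rootE => /(nthP 0)[m].
rewrite sz_rs => lt_m mE; exists (Ordinal lt_m).
by apply: rmorphism_theta_inj; rewrite sP.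
Qed.

(* A subfield [E] is determined by [minPoly E theta], whose image in [L] is
   the product of a subsequence of the linear factors of [p]. *)
Lemma finitely_many_subfields :
  exists s : seq {vspace K}, forall E : {subfield K}, (E : {vspace K}) \in s.
Proof.
have [rs prs] := closed_field_poly_normal (map_poly (ratr : rat -> L) p).
rewrite (monicP _) ?map_monic ?monic_rat_minPoly // scale1r in prs.
have dim_gt0 : (0 < \dim {:K})%N by exact: adim_gt0.
have [t _] := exists_all_embeddings; pose s := t (Ordinal dim_gt0).
pose ps := [seq \prod_(z <- mask b rs) ('X - z%:P) | b : (size rs).-tuple bool].
have minE (E : {subfield K}) : map_poly s (minPoly E theta) \in ps.
  have : map_poly s (minPoly E theta) %| map_poly s (minPoly 1 theta).
    by rewrite dvdp_map minPolyS ?sub1v.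
  rewrite -pE -map_poly_comp (eq_map_poly (fmorph_eq_rat (s \o in_alg K))) prs.
  move=> /dvdp_prod_XsubC[b]; have [b' szb ->] := resize_mask b rs.
  rewrite eqp_monic ?map_monic ?monic_minPoly //; last exact: monic_prod_XsubC.
  by move/eqP => ->; apply/codomP; exists (Tuple (introT eqP szb)).
(* Each candidate polynomial comes from at most one subfield, so the induction adds at most one
   entry per candidate. *)
have [fs fsP] : exists fs : seq {vspace K}, forall E : {subfield K},
    map_poly s (minPoly E theta) \in ps -> (E : {vspace K}) \in fs.
  elim: ps {minE} => [|q ps [fs fsP]]; first by exists [::].
  have [[E0 qE0]|nE] :=
      pselect (exists E : {subfield K}, map_poly s (minPoly E theta) = q).
    exists ((E0 : {vspace K}) :: fs) => E; rewrite !inE => /orP[/eqP|/fsP->].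
      rewrite -qE0 => /map_poly_inj/(subfield_minPoly_inj theta_gen) ->.
      by rewrite eqxx.
    by rewrite orbT.
  exists fs => E; rewrite inE => /orP[/eqP Eq|/fsP//].
  by case: nE; exists E.
by exists fs => E; apply: fsP.
Qed.

End PrimitiveElement.

Lemma subfield_generator (K : fieldExtType rat) (E F : {subfield K}) :
  (E <= F)%VS -> exists x : K, <<E; x>>%VS = F.
Proof.
move=> EF; exists (separable_generator E F).
apply/esym/eq_adjoin_separable_generator => //.
apply/separableP => x _; apply: pcharf0_separable => y.
by rewrite pchar_lalg pchar_num.
Qed.

Lemma primitive_element (K : fieldExtType rat) :
  exists theta : K, <<1; theta>>%VS = fullv.
Proof. exact: (subfield_generator (subvf 1%AS : (1%AS <= {:K}%AS)%VS)). Qed.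

(** * The absolute value *)

Import ComplexField.Normc.

Lemma normc_ge0 (R : realType) (z : R[i]) : 0 <= normc z.
Proof. by case: z => a b; apply: sqrtr_ge0. Qed.

Lemma normc_sum (R : realType) (I : finType) (F : I -> R[i]) :
  normc (\sum_i F i) <= \sum_i normc (F i).
Proof.
elim/big_ind2: _ => [|x1 x2 y1 y2 le1 le2|//]; first by rewrite normc0.
by apply: le_trans (le_normcD _ _) _; apply: lerD.
Qed.

Lemma normc_ratr (R : realType) (q : rat) : normc (ratr q : R[i]) = `|ratr q : R|.
Proof.
by rewrite -(fmorph_rat (real_complex R)) /= expr0n /= addr0 sqrtr_sqr.
Qed.

(** Injectivity at [theta] ensures that no embedding is counted twice; it serves again for the
    Vandermonde determinant. *)
Lemma exists_embeddings (R : realType) (K : fieldExtType rat) :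
  exists theta : K, exists s : 'I_(\dim {:K}) -> {rmorphism K -> R[i]},
    injective (fun m => s m theta) /\
    forall x, absK R x =
      Num.sqrt ((\dim {:K})%:R^-1 * \sum_m normc (s m x) ^+ 2).
Proof.
have [theta theta_gen] := primitive_element K; exists theta.
have /polyOver1P[p pE] := minPolyOver 1%AS theta.
have [s [s_inj s_all]] := exists_all_embeddings theta_gen (esym pE) R[i].
exists s; split=> // x; rewrite /absK; congr (Num.sqrt (_ * _)).
pose f (m : 'I_(\dim {:K})) : K -> R[i] := s m.
have -> : embeddings R K = (f @` setT)%classic.
  apply/seteqP; split=> _ [t _ <-]; last by exists (s t).
  by have [m tE] := s_all t; exists m => //; apply/funext => y; rewrite tE.
rewrite fsbig_image => [|m m' _ _ ff]; last by apply: s_inj; rewrite -/(f m) ff.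
rewrite (fsbigE (index_enum _)) ?index_enum_uniq //.
  by apply: eq_bigl => m; rewrite in_setT.
by move=> m _; rewrite mem_index_enum.
Qed.

Section AbsoluteValue.
Variables (R : realType) (K : fieldExtType rat).
Local Notation n := (\dim {:K}).
Implicit Types x y : K.

Lemma dim_gt0 : 0 < n%:R :> R.
Proof. by rewrite ltr0n; apply: adim_gt0. Qed.

Lemma absK_ge0 x : 0 <= absK R x.
Proof. exact: sqrtr_ge0. Qed.

(** For nonnegative terms, a sum of products is at most the product of the sums; the factor [sqrt n]
    makes up for the second normalization by [1/n]. *)
Lemma absK_mul_le x y :
  absK R (x * y) <= Num.sqrt n%:R * absK R x * absK R y.
Proof.
have [theta [s [_ absE]]] := exists_embeddings R K.
have n_gt0 := dim_gt0.
have sum_ge0 z : 0 <= \sum_m normc (s m z) ^+ 2.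
  by apply: sumr_ge0 => m _; apply: exprn_ge0; apply: normc_ge0.
rewrite !absE -!sqrtrM ?mulr_ge0 ?invr_ge0 ?ler0n //.
rewrite ler_sqrt ?mulr_ge0 ?invr_ge0 ?ler0n //.
rewrite (mulrA n%:R) mulfV ?gt_eqF // mul1r mulrCA ler_pM2l ?invr_gt0 //.
rewrite mulr_suml ler_sum // => m _; rewrite rmorphM normcM exprMn.
rewrite ler_wpM2l ?exprn_ge0 ?normc_ge0 // (bigD1 m) //= lerDl.
by apply: sumr_ge0 => m' _; apply: exprn_ge0; apply: normc_ge0.
Qed.

(* The matrix of the embeddings on the basis is invertible, by comparison with
   a Vandermonde matrix at the conjugates of a primitive element. *)
Lemma coord_bounded (X : n.-tuple K) : basis_of {:K} X ->
  exists2 C : R, 0 < C &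
    forall p x, `|ratr (coord X p x) : R| <= C * absK R x.
Proof.
move=> Xbasis; have [theta [s [s_inj absE]]] := exists_embeddings R K.
have sqn_gt0 : 0 < Num.sqrt n%:R :> R by rewrite sqrtr_gt0 dim_gt0.
have normc_le m x : normc (s m x) <= Num.sqrt n%:R * absK R x.
  rewrite absE -sqrtrM ?ler0n // mulrA mulfV ?mul1r ?gt_eqF ?dim_gt0 //.
  rewrite -[X in X <= _]ger0_norm ?normc_ge0 // -sqrtr_sqr.
  rewrite ler_sqrt ?sqr_ge0 //; last first.
    by apply: sumr_ge0 => m' _; apply: exprn_ge0; apply: normc_ge0.
  rewrite (bigD1 m) //= lerDl.
  by apply: sumr_ge0 => m' _; apply: exprn_ge0; apply: normc_ge0.
pose M : 'M[R[i]]_n := \matrix_(p, m) s m X`_p.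
have sE x m : s m x = \sum_p ratr (coord X p x) * s m X`_p.
  rewrite {1}(coord_basis Xbasis (memvf x)) rmorph_sum; apply: eq_bigr => p _.
  rewrite -mulr_algl rmorphM; congr (_ * _).
  exact: (fmorph_eq_rat (s m \o in_alg K)).
have Munit : M \in unitmx.
  pose Q : 'M[R[i]]_n := \matrix_(p', p) ratr (coord X p (theta ^+ p')).
  have QM : Q *m M = Vandermonde n (\row_m s m theta).
    apply/matrixP => p' m; rewrite !mxE -rmorphXn sE.
    by apply: eq_bigr => p _; rewrite !mxE.
  have : \det (Q *m M) != 0.
    rewrite QM det_Vandermonde; apply/prodf_neq0 => m _; apply/prodf_neq0 => m' lt.
    rewrite !mxE subr_eq0; apply: contraTneq lt => /s_inj->.
    by rewrite ltnn.
  by rewrite det_mulmx mulf_eq0 negb_or unitmxE unitfE => /andP[].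
(* [S] bounds the entries of the inverse matrix; [S + 1] is used below to make the constant
   positive. *)
pose S := \sum_p \sum_m normc (invmx M m p).
have S_ge0 : 0 <= S.
  by do 2!apply: sumr_ge0 => ? _; apply: normc_ge0.
exists (Num.sqrt n%:R * (S + 1)) => [|p x]; first by rewrite mulr_gt0 // ltr_wpDl.
have rowE : \row_m s m x = \row_p ratr (coord X p x) *m M.
  by apply/rowP => m; rewrite !mxE sE; apply: eq_bigr => p' _; rewrite !mxE.
have cE : ratr (coord X p x) = \sum_m s m x * invmx M m p.
  have /rowP/(_ p) : \row_m s m x *m invmx M = \row_p ratr (coord X p x).
    by rewrite rowE mulmxK.
  by rewrite !mxE => <-; apply: eq_bigr => m _; rewrite mxE.
rewrite -normc_ratr cE; apply: le_trans (normc_sum _) _.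
rewrite mulrAC.
apply: (@le_trans _ _ (\sum_m Num.sqrt n%:R * absK R x * normc (invmx M m p))).
  by apply: ler_sum => m _; rewrite normcM ler_wpM2r ?normc_ge0.
rewrite -mulr_sumr ler_wpM2l ?mulr_ge0 ?absK_ge0 ?sqrtr_ge0 //.
apply: ler_wpDr => //; rewrite /S [leRHS](bigD1 p) //= lerDl.
by do 2!apply: sumr_ge0 => ? _; apply: normc_ge0.
Qed.

Lemma absK_eq0 x : (absK R x == 0) = (x == 0).
Proof.
apply/idP/eqP => [/eqP x0|->].
  have [C _ Cx] := coord_bounded (vbasisP {:K}).
  rewrite (coord_vbasis (memvf x)) big1 // => p _.
  have := Cx p x; rewrite x0 mulr0 normr_le0 fmorph_eq0 => /eqP ->.
  by rewrite scale0r.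
have [theta [s [_ ->]]] := exists_embeddings R K.
by rewrite big1 ?mulr0 ?sqrtr0 ?eqxx // => m _; rewrite rmorph0 normc0 expr0n.
Qed.

(** The coordinates of [d * x] are integers, bounded by [coord_bounded]. The denominator [d] lets
    the lemma serve fractional ideals. *)
Lemma finite_ball (X : n.-tuple K) (d : K) (L : set K) (r : R) :
    basis_of {:K} X -> d != 0 ->
    (forall x p, L x -> coord X p (d * x) \is a Num.int) ->
  exists s : seq K, forall x, L x -> absK R x <= r -> x \in s.
Proof.
move=> Xbasis d0 Lint; have [C C_gt0 Cx] := coord_bounded Xbasis.
pose B := C * (Num.sqrt n%:R * absK R d * r).
pose N := Num.bound B.
(* The shift by [N] turns the values 0 to [2 * N] into all integers of size at most [N]. *)
pose g (f : {ffun 'I_n -> 'I_(2 * N).+1}) : K :=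
  d^-1 * \sum_p ((f p)%:R - N%:R) *: X`_p.
exists (codom g) => x Lx xr.
have cN p : `|coord X p (d * x)| <= N%:R.
  rewrite -(ler_rat R) ratr_norm rmorph_nat.
  apply: le_trans (Cx _ _) _; apply: le_trans (ltW (archi_boundP _)).
    rewrite ler_wpM2l ?(ltW C_gt0) //; apply: le_trans (absK_mul_le _ _) _.
    by rewrite ler_wpM2l ?mulr_ge0 ?sqrtr_ge0 ?absK_ge0.
  rewrite !mulr_ge0 ?(ltW C_gt0) ?sqrtr_ge0 ?absK_ge0 //.
  exact: le_trans (absK_ge0 _) xr.
have fP p : exists k : 'I_(2 * N).+1, coord X p (d * x) = k%:R - N%:R.
  have /intrP[z zE] := Lint x p Lx; have := cN p; rewrite zE => zN.
  have {}zN : (`|z| <= N)%N.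
    by rewrite -(ler_nat rat) natr_absz intr_norm.
  have lt_k : (`|(z + N%:Z)%R| < (2 * N).+1)%N by lia.
  exists (Ordinal lt_k) => /=; apply/(addIr N%:R); rewrite subrK.
  rewrite -[X in _ + X]/(N%:Z%:~R) -intrD -[RHS]/(_%:Z%:~R).
  by congr (_%:~R); lia.
have [k kP] := choice fP; apply/codomP; exists [ffun p => k p]; rewrite /g.
apply/(mulfI d0); rewrite mulrA mulfV // mul1r.
rewrite {1}(coord_basis Xbasis (memvf (d * x))); apply: eq_bigr => p _.
by rewrite ffunE kP.
Qed.

End AbsoluteValue.

(** * Lattices and successive minima *)

Lemma common_denominator (I : finType) (c : I -> rat) :
  exists2 N : nat, (0 < N)%N & forall i, N%:R * c i \is a Num.int.
Proof.
exists (\prod_i `|denq (c i)|)%N.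
  by rewrite prodn_gt0 // => i; rewrite absz_gt0 denq_neq0.
move=> i; rewrite (bigD1 i) //= natrM mulrAC pmulrn absz_denq.
by rewrite (mulrC _ (c i)) -numqE rpredM ?natr_int ?intr_int.
Qed.

(** The images of the unit vectors are free over the rationals: a relation, cleared of denominators,
    is an integer vector killed by the injective [phi]. *)
Lemma lattice_basis (K : fieldExtType rat) (L : set K) : full_rank_lattice L ->
  exists X : (\dim {:K}).-tuple K, [/\ basis_of {:K} X, forall p : 'I_(\dim {:K}), L X`_p &
    forall x p, L x -> coord X p x \is a Num.int].
Proof.
move=> [phi [phi_inj ->]].
pose X := [tuple phi (delta_mx 0 p) | p < \dim {:K}].
have XE (p : 'I_(\dim {:K})) : X`_p = phi (delta_mx 0 p) by rewrite -tnth_nth tnth_mktuple.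
have phiE v : phi v = \sum_p (v 0 p)%:~R *: X`_p.
  rewrite {1}(row_sum_delta v) raddf_sum; apply: eq_bigr => p _.
  by rewrite scaler_int XE -raddfMz -{1}[v 0 p]intz scaler_int.
have Xfree : free X.
  apply/freeP => k k0 p.
  have [N N_gt0 NP] := common_denominator k.
  have zP q : exists z : int, N%:R * k q = z%:~R by apply/intrP.
  have [z {}zP] := choice zP.
  have : phi (\row_q z q) = 0.
    transitivity (N%:R *: \sum_q k q *: X`_q); last by rewrite k0 scaler0.
    rewrite phiE scaler_sumr.
    by apply: eq_bigr => q _; rewrite mxE -zP scalerA.
  rewrite -(raddf0 phi) => /phi_inj/rowP/(_ p); rewrite !mxE => zp0.
  have /eqP := zP p; rewrite zp0 mulf_eq0 pnatr_eq0 eqn0Ngt N_gt0 /=.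
  by move/eqP.
exists X; split.
- by rewrite basisEfree Xfree subvf size_tuple leqnn.
- by move=> p; exists (delta_mx 0 p); rewrite // XE.
- by move=> _ p [v _ <-]; rewrite phiE coord_sum_free // intr_int.
Qed.

Lemma basis_mulr (K : fieldExtType rat) (X : (\dim {:K}).-tuple K) (x : K) :
  x != 0 -> basis_of {:K} X -> basis_of {:K} [tuple of map (amull x) X].
Proof.
move=> x0 Xbasis; have ker0 : lker (amull x) == 0%VS.
  by apply/lker0P => a b; rewrite !lfunE; apply: mulfI.
have : basis_of (amull x @: {:K}) (map (amull x) X).
  by apply: limg_basis_of Xbasis; rewrite (eqP ker0) capv0.
by rewrite lker0_limgf.
Qed.

(** * Orders and their fractional ideals *)

Section Ideals.
Variables (K : fieldExtType rat) (O : set K).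
Hypothesis Oorder : is_order O.

Lemma order1 : O 1.
Proof. by case: Oorder => -[+ _ _] _; rewrite in_setE. Qed.

Lemma orderB x y : O x -> O y -> O (x - y).
Proof.
by case: Oorder => -[_ + _] _ Ox Oy => /(_ x y); rewrite !in_setE; apply.
Qed.

Lemma orderM x y : O x -> O y -> O (x * y).
Proof.
by case: Oorder => -[_ _ +] _ Ox Oy => /(_ x y); rewrite !in_setE; apply.
Qed.

Lemma fractional_ideal_self : fractional_ideal O O.
Proof.
have O0 : O 0 by rewrite -(subrr 1); apply: orderB; exact: order1.
split=> //.
- move=> x y Ox Oy; rewrite -[y]opprK -[- y]sub0r.
  by do 2!apply: orderB => //.
- exact: orderM.
- by exists 1; rewrite ?oner_eq0 //; exact: order1.
by exists 1; [split; [exact: order1 | rewrite oner_eq0] | move=> x; rewrite mul1r].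
Qed.

(** A nonzero element of [I] multiplies a basis of [K] lying in [O] into one lying in [I]. *)
Lemma fractional_ideal_basis (I : set K) : fractional_ideal O I ->
  exists X : (\dim {:K}).-tuple K, basis_of {:K} X /\ forall p : 'I_(\dim {:K}), I X`_p.
Proof.
case=> _ _ IM [x Ix x0] _.
have [X [Xbasis OX _]] := lattice_basis Oorder.2.
exists [tuple of map (amull x) X]; split; first exact: basis_mulr.
move=> p; rewrite (nth_map 0) ?size_tuple // lfunE /= mulrC.
exact: IM.
Qed.

Lemma fractional_ideal_finite_ball (R : realType) (I : set K) (r : R) :
  fractional_ideal O I ->
  exists s : seq K, forall x, I x -> absK R x <= r -> x \in s.
Proof.
case=> _ _ _ _ [d [_ d0] dI].
have [X [Xbasis _ Oint]] := lattice_basis Oorder.2.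
by apply: (finite_ball _ Xbasis d0) => x p /dI; apply: Oint.
Qed.

End Ideals.

(** * Existence of the successive minima *)

Lemma exists_min_in_seq (R : realType) (s : seq R) (P : R -> Prop) :
  (exists2 v, v \in s & P v) ->
  exists v, [/\ v \in s, P v & forall w, w \in s -> P w -> v <= w].
Proof.
elim: s => [[]//|u s IHs] Pex.
have [/IHs[v [sv Pv minv]]|nPs] := pselect (exists2 v, v \in s & P v).
  have [[Pu uv]|nu] := pselect (P u /\ u <= v).
    exists u; rewrite mem_head; split=> // w; rewrite inE => /orP[/eqP->//|sw Pw].
    exact: le_trans uv (minv w sw Pw).
  exists v; rewrite inE sv orbT; split=> // w; rewrite inE => /orP[/eqP->|] //.
    by move=> Pu; have [//|/ltW uv] := leP v u; case: nu.
  exact: minv.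
case: Pex => v; rewrite inE => /orP[/eqP->|sv] Pv; last by case: nPs; exists v.
exists u; rewrite mem_head; split=> // w; rewrite inE => /orP[/eqP->//|sw Pw].
by case: nPs; exists w.
Qed.

Lemma exists_max_in_seq (R : realType) (s : seq R) (P : R -> Prop) :
  (exists2 v, v \in s & P v) ->
  exists v, [/\ v \in s, P v & forall w, w \in s -> P w -> w <= v].
Proof.
case=> v sv Pv.
have [|u [/mapP[w sw ->] Pu minu]] :=
    @exists_min_in_seq R (map -%R s) (fun x => P (- x)).
  by exists (- v); rewrite ?map_f ?opprK.
exists w; split; [by [] | by rewrite -[w]opprK | move=> x sx Px].
by rewrite -lerN2; apply: minu; rewrite ?map_f ?opprK.
Qed.

Section SuccessiveMinima.
Variables (R : realType) (K : fieldExtType rat).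

Definition ball_span (L : set K) (r : R) : {vspace K} :=
  qspan (fun x => L x /\ absK R x <= r).

(** The span grows only when [r] reaches the size of an element of [L], and there are finitely many
    such sizes below any bound. *)
Lemma succ_minP (i : nat) (L : set K) :
    (i < \dim {:K})%N ->
    (exists X : (\dim {:K}).-tuple K, basis_of {:K} X /\ forall p : 'I_(\dim {:K}), L X`_p) ->
    (forall r : R, exists s : seq K, forall x, L x -> absK R x <= r -> x \in s) ->
  [/\ 0 < succ_min R i L, (i < \dim (ball_span L (succ_min R i L)))%N &
    forall r, 0 < r -> (i < \dim (ball_span L r))%N -> succ_min R i L <= r].
Proof.
move=> lti [X [Xbasis LX]] finL.
pose A (r : R) := 0 < r /\ (i < \dim (ball_span L r))%N.
suff : exists r, A r /\ forall s, A s -> r <= s.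
  case/(@xgetPex _ 0 (fun r => A r /\ forall s, A s -> r <= s)) => -[l0 li] minl.
  by split=> // r r0 ir; apply: minl.
have [r0 Ar0] : exists r, A r.
  exists (1 + \sum_(p < \dim {:K}) absK R X`_p); split.
    by rewrite ltr_pwDl // sumr_ge0 // => p _; apply: absK_ge0.
  suff /dimvS : (fullv <= ball_span L (1 + \sum_(p < \dim {:K}) absK R X`_p))%VS.
    exact: leq_trans.
  rewrite -[X in (X <= _)%VS](span_basis Xbasis); apply/span_subvP => x /tnthP[p ->].
  rewrite (tnth_nth 0); apply: mem_qspan; split=> //.
  rewrite (bigD1 p) //= addrCA lerDl addr_ge0 // sumr_ge0 // => q _.
  exact: absK_ge0.
have [s sP] := finL r0.
(* A radius can be lowered to the largest nonzero size not above it without losing dimension; size 0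
   is excluded because [A] asks for a positive radius. *)
have attained r : A r -> r <= r0 ->
    exists v, [/\ v \in map (@absK R K) s, A v & v <= r].
  move=> [r_gt0 ir] rr0.
  pose P v := exists x, [/\ L x, absK R x = v, v <= r & v != 0].
  have [[x [Lx xr x0]]|none] :=
      pselect (exists x, [/\ L x, absK R x <= r & x != 0]); last first.
    have /dimvS : (ball_span L r <= 0)%VS.
      apply: qspan_sub => x [Lx xr]; rewrite memv0; apply/negP => /negP x0.
      by apply: none; exists x.
    by rewrite dimv0 leqn0 => /eqP d0; rewrite d0 in ir.
  have [|v [sv [y [Ly yv vr v0]] maxv]] := @exists_max_in_seq R (map (@absK R K) s) P.
    exists (absK R x); last by exists x; rewrite absK_eq0.
    by rewrite map_f // sP // (le_trans xr).
  exists v; split=> //; split.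
    by rewrite lt_neqAle eq_sym v0 -yv absK_ge0.
  apply: leq_trans ir _; apply: dimvS; apply: qspan_sub => z [Lz zr].
  apply: mem_qspan; split=> //.
  have [->|z0] := eqVneq z 0.
    by have /eqP -> : absK R (0 : K) == 0; rewrite ?absK_eq0 // -yv absK_ge0.
  apply: maxv; first by rewrite map_f // sP // (le_trans zr).
  by exists z; rewrite absK_eq0.
have [v [sv Av vr0]] := attained r0 Ar0 (lexx _).
have [|w [sw Aw minw]] := @exists_min_in_seq R (map (@absK R K) s) A.
  by exists v.
exists w; split=> // r Ar; have [rr0|/ltW r0r] := leP r r0.
  have [u [su Au ur]] := attained r Ar rr0.
  exact: le_trans (minw u su Au) ur.
by apply: le_trans r0r; apply: le_trans vr0; apply: minw.
Qed.

Lemma order_succ_minP (i : nat) (O I : set K) :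
    is_order O -> fractional_ideal O I -> (i < \dim {:K})%N ->
  [/\ 0 < succ_min R i I, (i < \dim (ball_span I (succ_min R i I)))%N &
    forall r, 0 < r -> (i < \dim (ball_span I r))%N -> succ_min R i I <= r].
Proof.
move=> Oorder Iideal lti; apply: succ_minP => //.
  exact: fractional_ideal_basis Iideal.
by move=> r; apply: fractional_ideal_finite_ball Iideal.
Qed.

Lemma succ_min_ideal_mul_le (i j : nat) (O I : set K) :
    is_order O -> fractional_ideal O I -> (i + j < \dim {:K})%N ->
    (forall H : {subfield K},
      i %% \dim H + j %% \dim H = (i + j) %% \dim H)%N ->
  succ_min R (i + j) I <=
    Num.sqrt (\dim {:K})%:R * succ_min R i I * succ_min R j O.
Proof.
move=> Oorder Iideal ltij modP.
have [li0 ri _] := order_succ_minP Oorder Iideal (leq_ltn_trans (leq_addr j i) ltij).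
have [lj0 rj _] := order_succ_minP Oorder (fractional_ideal_self Oorder)
  (leq_ltn_trans (leq_addl i j) ltij).
have [_ _ minij] := order_succ_minP Oorder Iideal ltij.
have [theta theta_gen] := primitive_element K.
have /polyOver1P[p pE] := minPolyOver 1%AS theta.
have [s sP] := finitely_many_subfields theta_gen (esym pE) R[i].
apply: minij; first by rewrite !mulr_gt0 // sqrtr_gt0 dim_gt0.
apply: leq_trans (dim_prodv_ge sP modP ri rj) _; apply: dimvS.
(* Applied once for each factor, [prodv_sub_of_gen] leaves a product of two short elements. *)
apply: prodv_sub_of_gen => x y [Ix xr] yO; rewrite mulrC.
suff /subvP : (ball_span O (succ_min R j O) * <[x]> <=
    ball_span I (Num.sqrt (\dim {:K})%:R * succ_min R i I * succ_min R j O))%VS.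
  by apply; rewrite memv_mul ?memv_line.
apply: prodv_sub_of_gen => {yO}y _ [Oy yr] /vlineP[k ->].
rewrite -scalerAr memvZ //; apply: mem_qspan; split.
  by case: Iideal => _ _ IM _ _; apply: IM.
rewrite mulrC; apply: le_trans (absK_mul_le _ _ _) _.
rewrite -!mulrA ler_wpM2l ?sqrtr_ge0 //.
by rewrite ler_pM ?absK_ge0.
Qed.

End SuccessiveMinima.

(** * Orders with skewed successive minima *)

(** The vector at position [m * \dim F + u] is [b ^+ u * a ^+ m], with [b] generating [F] and [a]
    generating [K] over [F]. A product of vectors from blocks [m] and [m'] is an element of [F]
    times [a ^+ (m + m')]: it stays in block [m + m'] if that block exists, and otherwise the bound
    holds for every [r]. *)
Lemma filtered_basis (K : fieldExtType rat) (F : {subfield K}) :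
  exists X : (\dim {:K}).-tuple K, [/\ basis_of {:K} X, X`_0 = 1 &
    forall p q r : 'I_(\dim {:K}), coord X r (X`_p * X`_q) != 0 ->
      (r %/ \dim F <= p %/ \dim F + q %/ \dim F)%N].
Proof.
have [b bF] := subfield_generator (sub1v F : (1%AS <= F)%VS).
have [a aK] := subfield_generator (subvf F : (F <= {:K}%AS)%VS).
rewrite /= in bF aK.
have k_gt0 : (0 < \dim F)%N by apply: adim_gt0.
have n_gt0 : (0 < \dim {:K})%N by apply: adim_gt0.
have kn : (\dim {:K} = \dim_F {:K} * \dim F)%N by apply/dim_sup_field/subvf.
pose X := [tuple b ^+ (p %% \dim F) * a ^+ (p %/ \dim F) | p < \dim {:K}].
have XE p : (p < \dim {:K})%N -> X`_p = b ^+ (p %% \dim F) * a ^+ (p %/ \dim F).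
  by move=> ltp; rewrite -(tnth_nth _ _ (Ordinal ltp)) tnth_mktuple.
have blockP x m : x \in F -> (m < \dim_F {:K})%N ->
    exists c : 'I_(\dim F) -> rat,
      x * a ^+ m = \sum_u c u *: X`_(m * \dim F + u).
  move=> Fx ltm; have := size_Fadjoin_poly 1 b x.
  have /polyOver1P[q qE] := Fadjoin_polyOver 1 b x.
  rewrite adjoin_degreeE bF dimv1 divn1 qE size_map_poly => szq.
  have xE : x = (map_poly (in_alg K) q).[b] by rewrite -qE Fadjoin_poly_eq ?bF.
  exists (fun u => q`_u); rewrite xE (@horner_coef_wide _ (\dim F)) ?size_map_poly //.
  rewrite mulr_suml; apply: eq_bigr => u _.
  rewrite coef_map /= mulr_algl -scalerAl XE.
    by rewrite modnMDl modn_small // divnMDl // divn_small ?addn0.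
  rewrite kn; apply: (@leq_trans (m.+1 * \dim F)); last by rewrite leq_mul2r ltm orbT.
  by rewrite mulSn addnC ltn_add2r.
have Xbasis : basis_of {:K} X.
  rewrite basisEdim size_tuple leqnn andbT; apply/subvP => x _.
  have xK : x \in <<F; a>>%VS by rewrite aK memvf.
  rewrite -(Fadjoin_poly_eq xK) (horner_coef_wide _ (size_Fadjoin_poly _ _ _)).
  apply: memv_suml => m _.
  have ltm : (m < \dim_F {:K})%N by rewrite (leq_trans (ltn_ord m)) // adjoin_degreeE aK.
  have [c ->] := blockP _ m (polyOverP (Fadjoin_polyOver F a x) m) ltm.
  apply: memv_suml => u _; rewrite memvZ // memv_span // mem_nth // size_tuple.
  rewrite kn; apply: (@leq_trans (m.+1 * \dim F)); last by rewrite leq_mul2r ltm orbT.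
  by rewrite mulSn addnC ltn_add2r.
exists X; split=> //; first by rewrite XE // mod0n div0n !expr0 mulr1.
move=> p q r; rewrite !XE // mulrACA -!exprD.
have ltr : (r %/ \dim F < \dim_F {:K})%N by rewrite ltn_divLR // -kn.
have [ltm|] := ltnP (p %/ \dim F + q %/ \dim F) (\dim_F {:K}); last first.
  by move=> le _; apply/ltnW/(leq_trans ltr).
have Fb : b \in F by rewrite -bF memv_adjoin.
have [c ->] := blockP _ _ (rpredX (p %% \dim F + q %% \dim F) Fb) ltm.
rewrite linear_sum => sum_neq0; rewrite leqNgt; apply: contra_neqN sum_neq0 => ltmr.
apply: big1 => u _; rewrite linearZ /=.
have lt_n : ((p %/ \dim F + q %/ \dim F) * \dim F + u < \dim {:K})%N.
  rewrite [leqRHS]kn; apply: (@leq_trans ((p %/ \dim F + q %/ \dim F).+1 * \dim F)).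
    by rewrite [leqRHS]mulSn addnC ltn_add2r.
  by rewrite leq_mul2r ltm orbT.
rewrite (coord_free (Ordinal lt_n) r (basis_free Xbasis)) /= -val_eqE /=.
case: eqP ltmr => [<-|_ _]; last by rewrite mulr0.
by rewrite divnMDl // (divn_small (ltn_ord u)) addn0 ltnn.
Qed.

(** Integral structure constants make the integer span of [Y], described here by coordinates, closed
    under products. *)
Lemma order_of_basis (K : fieldExtType rat) (Y : (\dim {:K}).-tuple K) :
    basis_of {:K} Y ->
    (forall r, coord Y r 1 \is a Num.int) ->
    (forall p q r : 'I_(\dim {:K}), coord Y r (Y`_p * Y`_q) \is a Num.int) ->
  is_order (fun x => forall r, coord Y r x \is a Num.int).
Proof.
move=> Ybasis Y1 YM; have YE x := coord_basis Ybasis (memvf x).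
split.
  split=> [|x y|x y]; rewrite ?in_setE // => xP yP r.
    by rewrite linearB rpredB ?xP ?yP.
  rewrite (YE x) (YE y) mulr_suml linear_sum rpred_sum // => p _.
  rewrite mulr_sumr linear_sum rpred_sum // => q _.
  by rewrite -scalerAl -scalerAr !linearZ /= !rpredM ?xP ?yP.
pose phi (v : 'rV[int]_(\dim {:K})) : K := \sum_p (v 0 p)%:~R *: Y`_p.
have phiB : {morph phi : u v / u - v}.
  move=> u v; rewrite /phi -sumrB; apply: eq_bigr => p _.
  by rewrite !mxE rmorphB scalerBl.
pose phi' : {additive 'rV[int]_(\dim {:K}) -> K} :=
  HB.pack phi (GRing.isZmodMorphism.Build _ _ phi phiB).
have coordE v p : coord Y p (phi v) = (v 0 p)%:~R.
  by rewrite coord_sum_free ?(basis_free Ybasis).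
exists phi'; split.
  move=> u v /= uv; apply/rowP => p; apply: (@intr_inj rat).
  by rewrite -!coordE uv.
apply/seteqP; split=> [x xP|_ [v _ <-] p]; last by rewrite coordE intr_int.
have [z zP] := choice (fun p => elimT intrP (xP p)).
exists (\row_p z p) => //=; rewrite [RHS]YE.
by apply: eq_bigr => p _; rewrite mxE zP.
Qed.

Lemma coord_rescale (K : fieldExtType rat) (X : (\dim {:K}).-tuple K)
    (w : 'I_(\dim {:K}) -> rat) (Y := [tuple w p *: X`_p | p < \dim {:K}]) :
    basis_of {:K} X -> (forall p, w p != 0) ->
  basis_of {:K} Y /\ forall r x, coord Y r x = coord X r x / w r.
Proof.
move=> Xbasis w0.
have YE (p : 'I_(\dim {:K})) : Y`_p = w p *: X`_p by rewrite -tnth_nth tnth_mktuple.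
have xE x : x = \sum_p (coord X p x / w p) *: Y`_p.
  rewrite {1}(coord_basis Xbasis (memvf x)); apply: eq_bigr => p _.
  by rewrite YE scalerA divfK.
have Ybasis : basis_of {:K} Y.
  rewrite basisEdim size_tuple leqnn andbT; apply/subvP => x _; rewrite (xE x).
  by apply: memv_suml => p _; rewrite memvZ // memv_span // mem_nth ?size_tuple.
by split=> // r x; rewrite {1}(xE x) coord_sum_free ?(basis_free Ybasis).
Qed.

Lemma absK_natZ (R : realType) (K : fieldExtType rat) (m : nat) (x : K) :
  absK R (m%:R *: x) = m%:R * absK R x.
Proof.
have [theta [s [_ absE]]] := exists_embeddings R K.
rewrite !absE -[m%:R in RHS](ger0_norm (ler0n R m)) -sqrtr_sqr -sqrtrM ?sqr_ge0 //.
congr Num.sqrt; rewrite mulrCA; congr (_ * _).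
rewrite mulr_sumr; apply: eq_bigr => p _.
rewrite scaler_nat rmorphMn -mulr_natl normcM exprMn.
by rewrite -(ratr_nat R[i]) normc_ratr ratr_nat ger0_norm.
Qed.

Lemma skewed_orders (K : fieldExtType rat) (F : {subfield K}) :
  exists (X : (\dim {:K}).-tuple K) (N : nat), [/\ basis_of {:K} X, (0 < N)%N &
    forall T : nat, (0 < T)%N -> exists (w : 'I_(\dim {:K}) -> nat) (O : set K),
      [/\ is_order O,
        forall x p, O x -> coord X p x / (w p)%:R \is a Num.int,
        forall p : 'I_(\dim {:K}), O ((w p)%:R *: X`_p),
        forall p, (0 < w p <= N * T ^ (p %/ \dim F))%N &
        forall p : 'I_(\dim {:K}), (0 < p)%N -> (T ^ (p %/ \dim F) <= w p)%N]].
Proof.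
have [X [Xbasis X0 Xfilt]] := filtered_basis F.
have [N N_gt0 NP] := common_denominator
  (fun t : 'I_(\dim {:K}) * 'I_(\dim {:K}) * 'I_(\dim {:K}) =>
  coord X t.2 (X`_t.1.1 * X`_t.1.2)).
exists X, N; split=> // T T_gt0.
(* Weight 1 at index 0 keeps the unit in the lattice; elsewhere [N] clears the denominators of the
   structure constants. *)
pose w (p : 'I_(\dim {:K})) := if p == 0%N :> nat then 1%N else (N * T ^ (p %/ \dim F))%N.
have w_gt0 p : (0 < w p)%N by rewrite /w; case: ifP => // _; rewrite muln_gt0 N_gt0 expn_gt0 T_gt0.
have w0 p : (w p)%:R != 0 :> rat by rewrite pnatr_eq0 -lt0n.
have [] := coord_rescale Xbasis w0.
set Y := [tuple _ | p < _] => Ybasis Ycoord.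
have YE (p : 'I_(\dim {:K})) : Y`_p = (w p)%:R *: X`_p by rewrite -tnth_nth tnth_mktuple.
have Yint (p r : 'I_(\dim {:K})) : coord Y r Y`_p \is a Num.int.
  by rewrite coord_free ?(basis_free Ybasis) // natr_int.
have Y0 (p : 'I_(\dim {:K})) : p = 0%N :> nat -> Y`_p = 1.
  by move=> p0; rewrite YE /w p0 /= X0 scale1r.
pose O : set K := fun x => forall r, coord Y r x \is a Num.int.
have NT m : N%:R * T%:R ^+ m != 0 :> rat.
  by rewrite mulf_neq0 ?expf_neq0 // pnatr_eq0 -lt0n.
exists w, O; split.
- apply: order_of_basis => // [r|p q r].
    have n_gt0 : (0 < \dim {:K})%N by apply: adim_gt0.
    by rewrite -(Y0 (Ordinal n_gt0)).
  have [p0|pn0] := eqVneq (p : nat) 0%N; first by rewrite (Y0 p p0) mul1r.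
  have [q0|qn0] := eqVneq (q : nat) 0%N; first by rewrite (Y0 q q0) mulr1.
  rewrite Ycoord !YE -scalerAl -scalerAr !linearZ /=.
  have alg (A B c : rat) : N%:R * A * (N%:R * B * c) = N%:R * (A * B) * (N%:R * c).
    by rewrite -!mulrA; congr (_ * (_ * _)); rewrite mulrCA.
  have : N%:R * coord X r (X`_p * X`_q) \is a Num.int := NP (p, q, r).
  have := Xfilt p q r.
  have [->|_ /(_ isT) le] := eqVneq (coord X r (X`_p * X`_q)) 0.
    by rewrite !mulr0 mul0r.
  move: (coord X r _) => c Nc; rewrite /w (negPf pn0) (negPf qn0).
  (* For [r = 0] the divisor is 1; otherwise the filtration makes the exponent of [T] left after
     division nonnegative. *)
  case: eqP => _; rewrite !natrM !natrX alg -exprD.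
    by rewrite divr1; apply: rpredM Nc; rewrite rpredM ?rpredX ?natr_int.
  rewrite -(subnKC le) exprD (mulrA N%:R) -(mulrA (N%:R * _)) mulrC mulKf ?NT //.
  by apply: rpredM Nc; rewrite rpredX ?natr_int.
- by move=> x p Ox; rewrite -Ycoord.
- by move=> p r; rewrite -YE.
- move=> p; rewrite w_gt0 /= /w; case: ifP => // _.
  by rewrite muln_gt0 N_gt0 expn_gt0 T_gt0.
- move=> p p_gt0; rewrite /w eqn0Ngt p_gt0 /=.
  by rewrite leq_pmull.
Qed.

(** The first [i + 1] scaled basis vectors are independent elements of [O] of size at most [r]. *)
Lemma succ_min_skewed_le (R : realType) (K : fieldExtType rat)
    (X : (\dim {:K}).-tuple K) (w : 'I_(\dim {:K}) -> nat) (O : set K)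
    (i : nat) (r : R) :
    basis_of {:K} X -> is_order O -> (forall p, (0 < w p)%N) ->
    (forall p : 'I_(\dim {:K}), O ((w p)%:R *: X`_p)) ->
    (i < \dim {:K})%N -> 0 < r ->
    (forall p : 'I_(\dim {:K}), (p <= i)%N -> (w p)%:R * absK R X`_p <= r) ->
  0 < succ_min R i O <= r.
Proof.
move=> Xbasis Oorder w_gt0 Ow lti r_gt0 wr.
have [-> _ /=] := order_succ_minP R Oorder (fractional_ideal_self Oorder) lti.
apply=> //.
have szX : size (take i.+1 X) = i.+1 by rewrite size_takel ?size_tuple.
have Xfree : free (take i.+1 X).
  by have := basis_free Xbasis; rewrite -{1}(cat_take_drop i.+1 X); apply: catl_free.
have := Xfree; rewrite /free szX => /eqP <-; apply: dimvS.
apply/span_subvP => x /(nthP 0)[p]; rewrite szX => lep <-.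
have ltp : (p < \dim {:K})%N by apply: leq_trans lti.
rewrite nth_take //; have w0 : (w (Ordinal ltp))%:R != 0 :> rat by rewrite pnatr_eq0 -lt0n.
rewrite -[X`_p](scalerK w0) memvZ //; apply: mem_qspan; split.
  exact: (Ow (Ordinal ltp)).
by rewrite absK_natZ; apply: (wr (Ordinal ltp)).
Qed.

(** The ball of radius [succ_min R i O] spans more than [l] dimensions, so it contains some [x] in
    [O] with a nonzero coordinate at some [p >= l]. That coordinate is an integer multiple of [w p],
    hence of size at least [r]. *)
Lemma succ_min_skewed_ge (R : realType) (K : fieldExtType rat)
    (X : (\dim {:K}).-tuple K) (w : 'I_(\dim {:K}) -> nat) (O : set K) (C r : R)
    (l i : nat) :
    basis_of {:K} X -> is_order O -> (forall p, (0 < w p)%N) ->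
    (forall x p, O x -> coord X p x / (w p)%:R \is a Num.int) ->
    (forall p x, `|ratr (coord X p x) : R| <= C * absK R x) -> 0 <= C ->
    (l <= i)%N -> (i < \dim {:K})%N ->
    (forall p : 'I_(\dim {:K}), (l <= p)%N -> r <= (w p)%:R) ->
  r <= C * succ_min R i O.
Proof.
move=> Xbasis Oorder w_gt0 Oint XC C_ge0 li lti wr.
have [_ dim_gt _] := order_succ_minP R Oorder (fractional_ideal_self Oorder) lti.
have [[x [Ox xr xW]]|none] := pselect (exists x, [/\ O x,
    absK R x <= succ_min R i O & x \notin <<take l X>>%VS]); last first.
  have /dimvS : (ball_span O (succ_min R i O) <= <<take l X>>)%VS.
    apply: qspan_sub => x [Ox xr]; apply/negPn/negP => xW.
    by apply: none; exists x.
  rewrite leqNgt => /negP[]; apply: leq_ltn_trans (dim_span _) _.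
  rewrite size_takel ?size_tuple; first exact: leq_ltn_trans dim_gt.
  exact: leq_trans li (ltnW lti).
have [p [lp xp]] : exists p : 'I_(\dim {:K}), (l <= p)%N /\ coord X p x != 0.
  apply: contrapT => nop; case/negP: xW.
  rewrite (coord_basis Xbasis (memvf x)); apply: memv_suml => p _.
  have [lp|pl] := leqP l p.
    have -> : coord X p x = 0; last by rewrite scale0r mem0v.
    by apply/eqP/negPn/negP => xp; apply: nop; exists p.
  rewrite memvZ // memv_span // -(nth_take 0 pl) mem_nth //.
  by rewrite size_take size_tuple; case: ifP => // _; apply: ltn_ord.
apply: le_trans (ler_wpM2l C_ge0 xr); apply: le_trans (XC p x).
apply: le_trans (wr p lp) _.
have /intrP[z zE] := Oint x p Ox.
have wp0 : (w p)%:R != 0 :> rat by rewrite pnatr_eq0 -lt0n.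
have xE : coord X p x = z%:~R * (w p)%:R by rewrite -zE divfK.
have z0 : z != 0 by apply: contraNneq xp => z0; rewrite xE z0 mul0r.
rewrite xE rmorphM /= ratr_int ratr_nat normrM normr_nat -intr_norm.
by rewrite ler_peMl // ler1z; lia.
Qed.

Lemma modn_add_of_succ_min_bound (R : realType) (K : fieldExtType rat) (c : R)
    (i j : nat) (F : {subfield K}) :
    0 < c -> (i + j < \dim {:K})%N ->
    (forall O : set K, is_order O ->
      succ_min R (i + j) O <= c * succ_min R i O * succ_min R j O) ->
  (i %% \dim F + j %% \dim F = (i + j) %% \dim F)%N.
Proof.
move=> c_gt0 ltij bound; set k := \dim F.
have k_gt0 : (0 < k)%N by apply: adim_gt0.
have [lt_k|ge_k] := ltnP (i %% k + j %% k) k; first by rewrite -[RHS]modnDm [RHS]modn_small.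
pose a := (i %/ k)%N; pose b := (j %/ k)%N.
(* The carry puts [i + j] at least one block beyond [a + b], while [i] and [j] lie in blocks [a] and
   [b]. *)
have le_ij : ((a + b).+1 * k <= i + j)%N.
  rewrite /a /b {2}(divn_eq i k) {2}(divn_eq j k); lia.
have [X [N [Xbasis N_gt0 skew]]] := skewed_orders F.
have [C C_gt0 XC] := coord_bounded R Xbasis.
pose S := \sum_(p < \dim {:K}) absK R X`_p.
have S_ge p : absK R (X`_(p : 'I_(\dim {:K}))) <= 1 + S.
  rewrite /S (bigD1 p) //= addrCA lerDl addr_ge0 // sumr_ge0 // => q _.
  exact: absK_ge0.
have S_gt0 : 0 < 1 + S.
  by rewrite ltr_pwDl // sumr_ge0 // => q _; apply: absK_ge0.
pose c1 := N%:R * (1 + S); have c1_gt0 : 0 < c1 by rewrite mulr_gt0 ?ltr0n.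
(* [B] collects the constants of the estimates below: a carry would force [T <= B], so [T] is taken
   larger. *)
pose B := C * (c * c1 * c1); have B_gt0 : 0 < B by rewrite /B !mulr_gt0 ?ltr0n.
pose T := Num.bound B; have BT : B < T%:R by apply/archi_boundP/ltW.
have T_gt0 : (0 < T)%N by rewrite -(ltr0n R) (lt_trans B_gt0).
have TR_gt0 : 0 < T%:R :> R by rewrite ltr0n.
have [w [O [Oorder Oint Ow wP w_ge]]] := skew T T_gt0.
have w_gt0 p : (0 < w p)%N by have /andP[] := wP p.
have upper m : (m < \dim {:K})%N ->
    0 < succ_min R m O <= c1 * T%:R ^+ (m %/ k).
  move=> ltm; apply: (succ_min_skewed_le Xbasis) => //.
    by rewrite mulr_gt0 ?exprn_gt0.
  move=> p lep; rewrite /c1 mulrAC ler_pM ?ler0n ?absK_ge0 //.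
  have /andP[_ wle] := wP p.
  rewrite -natrX -natrM ler_nat (leq_trans wle) // leq_mul2l.
  by rewrite leq_pexp2l ?orbT // leq_div2r.
have /andP[ui_gt0 ui] := upper i (leq_ltn_trans (leq_addr j i) ltij).
have /andP[uj_gt0 uj] := upper j (leq_ltn_trans (leq_addl i j) ltij).
have lower : T%:R ^+ (a + b).+1 <= C * succ_min R (i + j) O.
  apply: (succ_min_skewed_ge Xbasis Oorder w_gt0 Oint XC (ltW C_gt0) le_ij ltij).
  move=> p lep; rewrite -natrX ler_nat (leq_trans _ (w_ge p _)) //.
    by rewrite leq_pexp2l // leq_divRL.
  by apply: leq_trans lep; rewrite muln_gt0.
suff : T%:R ^+ (a + b).+1 <= B * T%:R ^+ (a + b).
  by rewrite exprS ler_pM2r ?exprn_gt0 // leNgt BT.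
apply: le_trans lower _.
have -> : B * T%:R ^+ (a + b) = C * (c * (c1 * T%:R ^+ a) * (c1 * T%:R ^+ b)).
  by rewrite /B exprD -(mulrA C) mulrACA -(mulrA c c1).
rewrite ler_pM2l //; apply: le_trans (bound O Oorder) _.
apply: ler_pM => //; first by rewrite ltW // mulr_gt0.
  exact: ltW.
by rewrite ler_pM2l.
Qed.

(** * Equivalence of the bounds on minima and the congruence condition *)

Theorem theorem1p5 (R : realType) (n : nat) (ks : seq nat) (i j : nat)
  (hn : (2 <= n)%N)
  (hks : sorted ltn ks)
  (hk1 : head 0%N ks = 1%N)
  (hkl : last 0%N ks = n)
  (hdvd : forall k : nat, k \in ks -> (k %| n)%N)
  (* Without a field of this kind, (3) and (4) hold vacuously while (1) and (2)
     fail; e.g. n = 12 with degrees 1, 2, 3, 12. *)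
  (hex : exists K : fieldExtType rat,
     \dim {:K} = n /\ subfields_have_degrees K ks)
  (hij : (i + j < n)%N) :
  [<->
    (* (1) *)
    exists K : fieldExtType rat,
      [/\ \dim {:K} = n, subfields_have_degrees K ks &
        exists2 c : R, 0 < c & forall O : set K, is_order O ->
          succ_min R (i + j) O <= c * succ_min R i O * succ_min R j O];
    (* (2) *)
    exists K : fieldExtType rat,
      [/\ \dim {:K} = n, subfields_have_degrees K ks &
        exists2 c : R, 0 < c & forall O I : set K,
          is_order O -> fractional_ideal O I ->
          succ_min R (i + j) I <= c * succ_min R i I * succ_min R j O];
    (* (3) *)
    forall K : fieldExtType rat,
      \dim {:K} = n -> subfields_have_degrees K ks ->
      forall O : set K, is_order O ->
        succ_min R (i + j) O <= Num.sqrt n%:R * succ_min R i O * succ_min R j O;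
    (* (4) *)
    forall K : fieldExtType rat,
      \dim {:K} = n -> subfields_have_degrees K ks ->
      forall O I : set K, is_order O -> fractional_ideal O I ->
        succ_min R (i + j) I <= Num.sqrt n%:R * succ_min R i I * succ_min R j O;
    (* (5) *)
    forall k : nat, k \in ks -> (i %% k + j %% k = (i + j) %% k)%N
  ].
Proof.
have sqrtn_gt0 : 0 < Num.sqrt n%:R :> R by rewrite sqrtr_gt0 ltr0n (leq_trans _ hn).
set P1 := ex _; set P2 := ex _; set P3 := (X in all_iff _ [:: _; X; _; _]).
set P4 := (X in all_iff _ [:: _; _; X; _]); set P5 := (X in all_iff _ [:: _; _; _; X]).
have P1P5 : P1 -> P5.
  move=> [K [Kn Kdeg [c c_gt0 bound]]] k /Kdeg[F <-].
  by apply: (modn_add_of_succ_min_bound F c_gt0) bound; rewrite Kn.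
have P5P4 : P5 -> P4.
  move=> modP K Kn Kdeg O I Oorder Iideal; rewrite -Kn.
  apply: succ_min_ideal_mul_le; rewrite // ?Kn // => H.
  by apply: modP; apply/Kdeg; exists H.
have P4P2 : P4 -> P2.
  (* The universal statement yields an existential one through the field supplied by [hex]. *)
  move=> h4; have [K [Kn Kdeg]] := hex; exists K; split=> //.
  by exists (Num.sqrt n%:R) => // O I; apply: h4.
have P4P3 : P4 -> P3.
  move=> h4 K Kn Kdeg O Oorder.
  by apply: h4 => //; apply: fractional_ideal_self.
have P2P1 : P2 -> P1.
  move=> [K [Kn Kdeg [c c_gt0 bound]]]; exists K; split=> //.
  by exists c => // O Oorder; apply: bound => //; apply: fractional_ideal_self.
have P3P1 : P3 -> P1.
  move=> h3; have [K [Kn Kdeg]] := hex; exists K; split=> //.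
  by exists (Num.sqrt n%:R) => // O; apply: h3.
tfae.
- by move=> /P1P5/P5P4/P4P2.
- by move=> /P2P1/P1P5/P5P4/P4P3.
- by move=> /P3P1/P1P5/P5P4.
- by move=> /P4P2/P2P1/P1P5.
- by move=> /P5P4/P4P2/P2P1.
Qed.
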